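(* Let $\alpha>0$, $U_0>0$ and $k>0$ be real, and set $\beta=\sqrt{2U_0}/\alpha$. Consider the Schrödinger equation for the parabolic barrier restricted to its support, $$\frac{d^2\psi(x)}{dx^2}+\left[\frac{2U_0}{\alpha^2}x^2-(2U_0-k^2)\right]\psi(x)=0,\qquad x\in[-\alpha,\alpha].$$ Define $$\psi_e(x)=e^{-\frac{i\beta}{2}x^2}\,M\!\left[\tfrac14\left(1+\tfrac{ik^2}{\beta}-i\alpha^2\beta\right),\tfrac12,\,i\beta x^2\right],$$ $$\psi_o(x)=x\sqrt{2\beta}\,e^{-\frac{i\beta}{2}x^2}\,M\!\left[\tfrac14\left(3+\tfrac{ik^2}{\beta}-i\alpha^2\beta\right),\tfrac32,\,i\beta x^2\right].$$ Then $\psi_e$ is an even solution and $\psi_o$ is an odd solution of this equation, they are linearly independent, and every solution of the equation on $[-\alpha,\alpha]$ is a linear combination of $\psi_e$ and $\psi_o$.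
   Context: $M[a,b,z]=\sum_{n\ge 0}\frac{(a)_n}{(b)_n}\frac{z^n}{n!}$ is the Kummer confluent hypergeometric function, where $(a)_n$ is the rising factorial. The equation is $\psi''+[k^2-2U(x)]\psi=0$ (units $\hbar=m=1$, particle with kinetic energy $k^2/2$) on the support of the barrier $U(x)=\frac{U_0}{\alpha^2}(\alpha^2-x^2)$ for $|x|\le\alpha$, $U(x)=0$ for $|x|\ge\alpha$. *)

(* Defs.v *)
From Stdlib Require Import Reals Factorial.
From Coquelicot Require Import Coquelicot.

Open Scope R_scope.

(* Coquelicot's [Series] is real-valued; a complex series is summed through its
   real and imaginary parts.  [CSeries_unique] relates this to [is_series]. *)
Definition CSeries (a : nat -> C) : C :=
  (Series (fun n => Re (a n)), Series (fun n => Im (a n))).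

Lemma CSeries_unique (a : nat -> C) (l : C) :
  is_series (V := C_NormedModule) a l -> CSeries a = l.
Proof.
intros Ha.
assert (Hfst : forall n, fst (sum_n (G := C_AbelianMonoid) a n)
                         = sum_n (fun k => Re (a k)) n).
{ induction n as [|n IH]; [now rewrite !sum_O|].
  rewrite !sum_Sn, <- IH; reflexivity. }
assert (Hsnd : forall n, snd (sum_n (G := C_AbelianMonoid) a n)
                         = sum_n (fun k => Im (a k)) n).
{ induction n as [|n IH]; [now rewrite !sum_O|].
  rewrite !sum_Sn, <- IH; reflexivity. }
destruct l as [x y].
unfold CSeries; f_equal; apply is_series_unique; intros P [eps HP];
  destruct (Ha (fun z : C => ball x eps (fst z) /\ ball y eps (snd z))) as [N HN];
  try (exists eps; intros z [H1 H2]; split; assumption);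
  exists N; intros n Hn; apply HP;
  destruct (HN n Hn) as [H1 H2].
- rewrite <- Hfst; exact H1.
- rewrite <- Hsnd; exact H2.
Qed.

Definition Cexp (z : C) : C :=
  (exp (Re z) * cos (Im z), exp (Re z) * sin (Im z)).

Fixpoint pochhammer (a : C) (n : nat) : C :=
  match n with
  | O => RtoC 1
  | S m => (pochhammer a m * (a + RtoC (INR m)))%C
  end.

Definition kummerM (a b z : C) : C :=
  CSeries (fun n : nat =>
    (pochhammer a n / pochhammer b n * (z ^ n / RtoC (INR (fact n))))%C).

(* The derivative of [f] at [x] relative to the set [D]: [is_derive] with the
   filter [locally x] restricted to [D].  On a nondegenerate closed interval it
   is the ordinary derivative inside and the one-sided one at the endpoints. *)
Definition is_derive_within (D : R -> Prop) (f : R -> C) (x : R) (l : C) : Prop :=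
  filterdiff (K := R_AbsRing) (U := R_NormedModule) (V := C_R_NormedModule)
    f (within D (locally x)) (fun y : R => scal y (l : C_R_NormedModule)).

Definition barrier (alpha x : R) : Prop := - alpha <= x <= alpha.

Definition is_solution (alpha U0 k : R) (psi : R -> C) : Prop :=
  exists dpsi ddpsi : R -> C,
    forall x : R, barrier alpha x ->
      is_derive_within (barrier alpha) psi x (dpsi x) /\
      is_derive_within (barrier alpha) dpsi x (ddpsi x) /\
      (ddpsi x
       + RtoC (2 * U0 / alpha ^ 2 * x ^ 2 - (2 * U0 - k ^ 2)) * psi x)%C = RtoC 0.

Definition even_on (D : R -> Prop) (f : R -> C) : Prop :=
  forall x : R, D x -> f (- x) = f x.

Definition odd_on (D : R -> Prop) (f : R -> C) : Prop :=
  forall x : R, D x -> f (- x) = (- f x)%C.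

Definition lin_indep_on (D : R -> Prop) (f g : R -> C) : Prop :=
  forall a b : C,
    (forall x : R, D x -> (a * f x + b * g x)%C = RtoC 0) ->
    a = RtoC 0 /\ b = RtoC 0.

Definition psi_e (alpha beta k : R) (x : R) : C :=
  (Cexp (- (Ci * RtoC beta / RtoC 2) * RtoC (x ^ 2))
   * kummerM (RtoC (1 / 4) *
                (RtoC 1 + Ci * RtoC (k ^ 2) / RtoC beta
                 - Ci * RtoC (alpha ^ 2) * RtoC beta))
             (RtoC (1 / 2))
             (Ci * RtoC beta * RtoC (x ^ 2)))%C.

Definition psi_o (alpha beta k : R) (x : R) : C :=
  (RtoC (x * sqrt (2 * beta))
   * Cexp (- (Ci * RtoC beta / RtoC 2) * RtoC (x ^ 2))
   * kummerM (RtoC (1 / 4) *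
                (RtoC 3 + Ci * RtoC (k ^ 2) / RtoC beta
                 - Ci * RtoC (alpha ^ 2) * RtoC beta))
             (RtoC (3 / 2))
             (Ci * RtoC beta * RtoC (x ^ 2)))%C.

(* Main.v *)
Require Import Defs.
From Stdlib Require Import Reals Lra Arith Factorial.
From Coquelicot Require Import Coquelicot.

Open Scope R_scope.

(** Put w = i beta and write [M(a, b, w t)] as a power series G in t = x^2 with
complex coefficients c_n.  Their recurrence c_(n+1) (b+n) (n+1) = (a+n) w c_n
is Kummer's equation t G'' + (b - w t) G' = a w G; multiplying G(x^2) by
exp(-w x^2 / 2), and by x when b = 3/2, turns it into the Schroedinger equation
since 4 a w - 2 b w = alpha^2 beta^2 - k^2 for both choices of a and b.

The Wronskian of two solutions is constant on the barrier.  With W(f,g) =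
f g' - f' g and W(psi_e, psi_o) = sqrt (2 beta) <> 0 at the origin, the identity
psi W(psi_e, psi_o) = psi_e W(psi, psi_o) - psi_o W(psi, psi_e) expands an
arbitrary solution psi. *)

(** * Derivatives relative to a set *)

Definition real_derive_within (D : R -> Prop) (f : R -> R) (x l : R) : Prop :=
  filterdiff (K := R_AbsRing) (U := R_NormedModule) (V := R_NormedModule)
    f (within D (locally x)) (fun y : R => scal y l).

Lemma within_proper (D : R -> Prop) (x : R) :
  D x -> ProperFilter (within D (locally x)).
Proof.
intros Dx; constructor; [|apply within_filter, locally_filter].
intros P HP; exists x.
exact (locally_singleton x _ HP Dx).
Qed.

Lemma within_filter_lim (D : R -> Prop) (x : R) :
  is_filter_lim (within D (locally x)) x.
Proof. intros P HP; apply filter_le_within, HP. Qed.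

Lemma within_filter_lim_unique (D : R -> Prop) (x y : R) :
  D x -> is_filter_lim (within D (locally x)) y -> y = x.
Proof.
intros Dx Hy.
destruct (Req_dec y x) as [E|E]; [exact E|exfalso].
assert (He : 0 < Rabs (x - y)) by (apply Rabs_pos_lt; lra).
assert (H := locally_singleton x _ (Hy _ (locally_ball y (mkposreal _ He))) Dx).
exact (Rlt_irrefl _ H).
Qed.

(** Both projections are linear, and conversely a pair of differentiable functions is
    differentiable. All complex calculus below reduces to real calculus on the two parts. *)
Lemma is_derive_within_components (D : R -> Prop) (f : R -> C) (x : R) (l : C) :
  is_derive_within D f x l <->
  real_derive_within D (fun y => fst (f y)) x (fst l) /\
  real_derive_within D (fun y => snd (f y)) x (snd l).
Proof.
split.
- intros H; split.
  + apply (filterdiff_comp (K := R_AbsRing) (U := R_NormedModule)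
      (V := C_R_NormedModule) (W := R_NormedModule) f
      (fun z : C => fst z) _ (fun z : C => fst z) H).
    apply filterdiff_linear, is_linear_fst.
  + apply (filterdiff_comp (K := R_AbsRing) (U := R_NormedModule)
      (V := C_R_NormedModule) (W := R_NormedModule) f
      (fun z : C => snd z) _ (fun z : C => snd z) H).
    apply filterdiff_linear, is_linear_snd.
- intros [H1 H2].
  apply filterdiff_ext with (f := fun y => (fst (f y), snd (f y)));
    [intros y; now destruct (f y)|].
  apply (filterdiff_comp_2 (K := R_AbsRing) (T := R_NormedModule)
    (U := R_NormedModule) (V := R_NormedModule) (W := C_R_NormedModule)
    _ _ (fun u v => (u, v)) _ _ (fun u v => (u, v)) H1 H2).
  apply filterdiff_ext with (f := fun t : R * R => t); [intros y; now destruct y|].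
  apply filterdiff_ext_lin with (l1 := fun t : R * R => t); [|intros y; now destruct y].
  apply (filterdiff_id (K := R_AbsRing) (V := C_R_NormedModule)).
Qed.

(** An ordinary derivative survives restriction of the filter to [D]; this brings derivatives of
    real functions on the line into the relative setting. *)
Lemma is_derive_within_pair (D : R -> Prop) (f g : R -> R) (x u v : R) :
  D x -> is_derive f x u -> is_derive g x v ->
  is_derive_within D (fun y => (f y, g y) : C) x (u, v).
Proof.
intros Dx Hf Hg; apply is_derive_within_components; split.
- pose proof (within_proper D x Dx).
  apply (filterdiff_locally f x _ (within_filter_lim D x)), Hf.
- pose proof (within_proper D x Dx).
  apply (filterdiff_locally g x _ (within_filter_lim D x)), Hg.
Qed.

Lemma real_derive_within_mult (D : R -> Prop) (f g : R -> R) (x u v : R) :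
  D x -> real_derive_within D f x u -> real_derive_within D g x v ->
  real_derive_within D (fun y => f y * g y) x (u * g x + f x * v).
Proof.
intros Dx Hf Hg.
pose proof (within_proper D x Dx) as HF.
apply filterdiff_ext_lin with
  (l1 := fun y : R => plus (mult (scal y u) (g x)) (mult (f x) (scal y v)));
  [|intros y; unfold scal, plus, mult; simpl; unfold mult; simpl; ring].
apply (filterdiff_comp_2 (K := R_AbsRing) (T := R_NormedModule)
  (U := R_NormedModule) (V := R_NormedModule) (W := R_NormedModule)
  f g Rmult _ _ (fun a b => plus (mult a (g x)) (mult (f x) b)) Hf Hg).
apply (filterdiff_mult (K := R_AbsRing) (f x, g x)); [|exact Rmult_comm].
(* It remains to see that the image of the filter under the pair [(f, g)] converges to [(f x, g x)]:
   this is continuity of [f] and [g] relative to [D]. *)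
intros P [eps HP].
assert (Lf : filterlim f (within D (locally x)) (locally (f x)))
  by (apply (filterdiff_continuous_aux (K := R_AbsRing) (U := R_NormedModule)
        (V := R_NormedModule)); [eexists; exact Hf|apply within_filter_lim]).
assert (Lg : filterlim g (within D (locally x)) (locally (g x)))
  by (apply (filterdiff_continuous_aux (K := R_AbsRing) (U := R_NormedModule)
        (V := R_NormedModule)); [eexists; exact Hg|apply within_filter_lim]).
assert (Hfg : within D (locally x)
    (fun y => ball (f x) eps (f y) /\ ball (g x) eps (g y)))
  by exact (filter_and (fun y => ball (f x) eps (f y)) (fun y => ball (g x) eps (g y))
      (Lf _ (locally_ball (f x) eps)) (Lg _ (locally_ball (g x) eps))).
revert Hfg; unfold filtermap; apply filter_imp.
intros y [H1 H2]; apply HP; split; assumption.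
Qed.

Lemma real_derive_within_plus (D : R -> Prop) (f g : R -> R) (x u v : R) :
  real_derive_within D f x u -> real_derive_within D g x v ->
  real_derive_within D (fun y => f y + g y) x (u + v).
Proof.
intros Hf Hg.
eapply filterdiff_ext_lin; [apply (filterdiff_plus_fct _ _ _ _ Hf Hg)|].
intros y; unfold scal, plus; simpl; unfold mult; simpl; ring.
Qed.

Lemma real_derive_within_minus (D : R -> Prop) (f g : R -> R) (x u v : R) :
  real_derive_within D f x u -> real_derive_within D g x v ->
  real_derive_within D (fun y => f y - g y) x (u - v).
Proof.
intros Hf Hg.
eapply filterdiff_ext_lin; [apply (filterdiff_minus_fct _ _ _ _ Hf Hg)|].
intros y; unfold scal, minus, plus, opp; simpl; unfold mult; simpl; ring.
Qed.

Lemma is_derive_within_plus (D : R -> Prop) (f g : R -> C) (x : R) (u v : C) :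
  is_derive_within D f x u -> is_derive_within D g x v ->
  is_derive_within D (fun y => f y + g y)%C x (u + v)%C.
Proof.
rewrite !is_derive_within_components; intros [F1 F2] [G1 G2]; split; simpl;
  now apply real_derive_within_plus.
Qed.

Lemma is_derive_within_minus (D : R -> Prop) (f g : R -> C) (x : R) (u v : C) :
  is_derive_within D f x u -> is_derive_within D g x v ->
  is_derive_within D (fun y => f y - g y)%C x (u - v)%C.
Proof.
rewrite !is_derive_within_components; intros [F1 F2] [G1 G2]; split; simpl;
  now apply real_derive_within_minus.
Qed.

Lemma is_derive_within_mult (D : R -> Prop) (f g : R -> C) (x : R) (u v : C) :
  D x -> is_derive_within D f x u -> is_derive_within D g x v ->
  is_derive_within D (fun y => f y * g y)%C x (u * g x + f x * v)%C.
Proof.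
intros Dx; rewrite !is_derive_within_components; intros [F1 F2] [G1 G2]; split; simpl.
- replace (fst u * fst (g x) - snd u * snd (g x) +
    (fst (f x) * fst v - snd (f x) * snd v))
    with ((fst u * fst (g x) + fst (f x) * fst v) -
      (snd u * snd (g x) + snd (f x) * snd v)) by ring.
  now apply real_derive_within_minus; apply real_derive_within_mult.
- replace (fst u * snd (g x) + snd u * fst (g x) +
    (fst (f x) * snd v + snd (f x) * fst v))
    with ((fst u * snd (g x) + fst (f x) * snd v) +
      (snd u * fst (g x) + snd (f x) * fst v)) by ring.
  now apply real_derive_within_plus; apply real_derive_within_mult.
Qed.

Lemma is_derive_within_ext (D : R -> Prop) (f g : R -> C) (x : R) (u v : C) :
  (forall y, f y = g y) -> u = v ->
  is_derive_within D f x u -> is_derive_within D g x v.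
Proof. intros H <-; now apply filterdiff_ext. Qed.

(** * Functions with vanishing derivative on a closed interval *)

Lemma is_derive_zero_const (f : R -> R) :
  (forall x, is_derive f x 0) -> forall x y, f x = f y.
Proof.
intros H x y.
destruct (MVT_gen f y x (fun _ => 0)) as [c [_ Hc]].
- intros z _; apply H.
- intros z _; apply continuity_pt_filterlim, (ex_derive_continuous f z).
  exists 0; apply H.
- lra.
Qed.

Definition clamp (alpha x : R) : R := Rmax (- alpha) (Rmin alpha x).

Lemma clamp_barrier (alpha x : R) : 0 < alpha -> barrier alpha (clamp alpha x).
Proof.
intros H; unfold barrier, clamp, Rmax, Rmin.
repeat destruct Rle_dec; lra.
Qed.

Lemma clamp_id (alpha x : R) : barrier alpha x -> clamp alpha x = x.
Proof.
unfold barrier, clamp, Rmax, Rmin; intros H.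
repeat destruct Rle_dec; lra.
Qed.

Lemma clamp_contraction (alpha x y : R) :
  Rabs (clamp alpha x - clamp alpha y) <= Rabs (x - y).
Proof.
unfold clamp, Rmax, Rmin.
repeat destruct Rle_dec; unfold Rabs; repeat destruct Rcase_abs; lra.
Qed.

(* Since [clamp] is a contraction, a vanishing derivative within the barrier
   makes [f] composed with [clamp] differentiable on the whole line with
   derivative zero, endpoints included. *)
Lemma real_derive_within_zero_const (alpha : R) (f : R -> R) :
  0 < alpha ->
  (forall x, barrier alpha x -> real_derive_within (barrier alpha) f x 0) ->
  forall x y, barrier alpha x -> barrier alpha y -> f x = f y.
Proof.
intros Ha H x y Hx Hy.
rewrite <- (clamp_id alpha x Hx), <- (clamp_id alpha y Hy).
apply (is_derive_zero_const (fun z => f (clamp alpha z))).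
clear x y Hx Hy; intros x; split; [apply is_linear_scal_l|].
intros x' Hx'.
replace x' with x
  by apply (is_filter_lim_locally_unique (K := R_AbsRing) (V := R_NormedModule) _ _ Hx').
clear x' Hx'; intros eps.
destruct (H (clamp alpha x) (clamp_barrier alpha x Ha)) as [_ Hd].
destruct (Hd _ (within_filter_lim _ _) eps) as [delta Hdelta].
exists delta; intros y Hy.
assert (Hc := clamp_contraction alpha y x).
specialize (Hdelta (clamp alpha y)).
(* The first bound is the relative derivative at the clamped point; the second is the contraction
   property. *)
refine (Rle_trans _ _ _ (_ : _ <= eps * Rabs (clamp alpha y - clamp alpha x)) _).
- refine (Rle_trans _ _ _ _ (Hdelta _ (clamp_barrier alpha y Ha))).
  + right; unfold norm, minus, plus, opp, scal; simpl; unfold abs, mult; simpl.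
    f_equal; ring.
  + apply Rle_lt_trans with (1 := Hc), Hy.
- apply Rmult_le_compat_l; [apply Rlt_le, eps|exact Hc].
Qed.

Lemma is_derive_within_zero_const (alpha : R) (f : R -> C) :
  0 < alpha ->
  (forall x, barrier alpha x -> is_derive_within (barrier alpha) f x (RtoC 0)) ->
  forall x y, barrier alpha x -> barrier alpha y -> f x = f y.
Proof.
intros Ha H x y Hx Hy; apply injective_projections.
- apply (real_derive_within_zero_const alpha (fun z => fst (f z)) Ha); trivial.
  intros z Hz; apply (proj1 (is_derive_within_components _ _ _ _) (H z Hz)).
- apply (real_derive_within_zero_const alpha (fun z => snd (f z)) Ha); trivial.
  intros z Hz; apply (proj1 (is_derive_within_components _ _ _ _) (H z Hz)).
Qed.

(** * Complex power series of a real variable *)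

Lemma Re_RtoC_mult (r : R) (z : C) : Re (RtoC r * z)%C = r * Re z.
Proof. unfold Re; simpl; ring. Qed.

Lemma Im_RtoC_mult (r : R) (z : C) : Im (RtoC r * z)%C = r * Im z.
Proof. unfold Im; simpl; ring. Qed.

(** Only the coefficients are complex: the variable will be [x ^ 2], so the theory of real power
    series applies to each part. *)
Definition is_Cpseries (c : nat -> C) (t : R) (l : C) : Prop :=
  is_pseries (fun n => Re (c n)) t (Re l) /\
  is_pseries (fun n => Im (c n)) t (Im l).

Definition Cpseries (c : nat -> C) (t : R) : C :=
  (PSeries (fun n => Re (c n)) t, PSeries (fun n => Im (c n)) t).

Definition Cpseries_deriv (c : nat -> C) (n : nat) : C :=
  (RtoC (INR (S n)) * c (S n))%C.

(** These are the coefficients of the series multiplied by its variable. *)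
Definition Cpseries_shift (c : nat -> C) (n : nat) : C :=
  match n with O => RtoC 0 | S m => c m end.

(** Infinite radius of convergence, phrased pointwise because this is the form in which convergence
    and termwise differentiation at [t] use it. *)
Definition entire (c : nat -> C) : Prop :=
  forall t : R, Rbar_lt (Rabs t) (CV_radius (fun n => Re (c n))) /\
                Rbar_lt (Rabs t) (CV_radius (fun n => Im (c n))).

Lemma Cpseries_ext (c d : nat -> C) (t : R) :
  (forall n, c n = d n) -> Cpseries c t = Cpseries d t.
Proof.
intros H; unfold Cpseries; f_equal; apply PSeries_ext; intros n; now rewrite H.
Qed.

Lemma is_Cpseries_unique (c : nat -> C) (t : R) (l : C) :
  is_Cpseries c t l -> Cpseries c t = l.
Proof.
intros [H1 H2]; destruct l; unfold Cpseries; f_equal; now apply is_pseries_unique.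
Qed.

Lemma is_Cpseries_plus (c d : nat -> C) (t : R) (l m : C) :
  is_Cpseries c t l -> is_Cpseries d t m ->
  is_Cpseries (fun n => c n + d n)%C t (l + m)%C.
Proof.
intros [C1 C2] [D1 D2]; split.
- exact (is_pseries_plus _ _ _ _ _ C1 D1).
- exact (is_pseries_plus _ _ _ _ _ C2 D2).
Qed.

Lemma is_Cpseries_scal (z : C) (c : nat -> C) (t : R) (l : C) :
  is_Cpseries c t l -> is_Cpseries (fun n => z * c n)%C t (z * l)%C.
Proof.
intros [C1 C2]; split.
- refine (is_pseries_minus _ _ _ _ _ (is_pseries_scal (fst z) _ _ _ (Rmult_comm _ _) C1)
    (is_pseries_scal (snd z) _ _ _ (Rmult_comm _ _) C2)).
- refine (is_pseries_plus _ _ _ _ _ (is_pseries_scal (fst z) _ _ _ (Rmult_comm _ _) C2)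
    (is_pseries_scal (snd z) _ _ _ (Rmult_comm _ _) C1)).
Qed.

Lemma is_Cpseries_shift (c : nat -> C) (t : R) (l : C) :
  is_Cpseries c t l -> is_Cpseries (Cpseries_shift c) t (RtoC t * l)%C.
Proof.
intros [C1 C2]; split.
- replace (Re (RtoC t * l)%C) with (t * Re l) by now rewrite Re_RtoC_mult.
  apply is_pseries_ext with (2 := is_pseries_incr_1 _ _ _ C1); now intros [|n].
- replace (Im (RtoC t * l)%C) with (t * Im l) by now rewrite Im_RtoC_mult.
  apply is_pseries_ext with (2 := is_pseries_incr_1 _ _ _ C2); now intros [|n].
Qed.

Lemma Cpseries_correct (c : nat -> C) (t : R) :
  entire c -> is_Cpseries c t (Cpseries c t).
Proof.
intros H; destruct (H t); split; apply PSeries_correct; now apply CV_radius_inside.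
Qed.

Lemma Cpseries_deriv_parts (c : nat -> C) (n : nat) :
  Re (Cpseries_deriv c n) = PS_derive (fun n => Re (c n)) n /\
  Im (Cpseries_deriv c n) = PS_derive (fun n => Im (c n)) n.
Proof.
unfold Cpseries_deriv, PS_derive.
now rewrite Re_RtoC_mult, Im_RtoC_mult.
Qed.

Lemma entire_deriv (c : nat -> C) : entire c -> entire (Cpseries_deriv c).
Proof.
intros H t; destruct (H t) as [H1 H2]; split.
- rewrite (CV_radius_ext _ (PS_derive (fun n => Re (c n)))), CV_radius_derive; trivial.
  intros n; apply Cpseries_deriv_parts.
- rewrite (CV_radius_ext _ (PS_derive (fun n => Im (c n)))), CV_radius_derive; trivial.
  intros n; apply Cpseries_deriv_parts.
Qed.

Lemma is_derive_within_Cpseries_sqr (D : R -> Prop) (c : nat -> C) (x : R) :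
  D x -> entire c ->
  is_derive_within D (fun y => Cpseries c (y ^ 2)) x
    (RtoC (2 * x) * Cpseries (Cpseries_deriv c) (x ^ 2))%C.
Proof.
intros Dx Hc; destruct (Hc (x ^ 2)) as [H1 H2].
assert (Hsq : is_derive (fun y : R => y ^ 2) x (2 * x)) by (auto_derive; trivial; ring).
eapply is_derive_within_ext;
  [intros y; reflexivity| |apply is_derive_within_pair; trivial].
2: exact (is_derive_comp _ _ _ _ _ (is_derive_PSeries _ _ H1) Hsq).
2: exact (is_derive_comp _ _ _ _ _ (is_derive_PSeries _ _ H2) Hsq).
assert (E : Cpseries (Cpseries_deriv c) (x ^ 2) =
  (PSeries (PS_derive (fun n => Re (c n))) (x ^ 2),
   PSeries (PS_derive (fun n => Im (c n))) (x ^ 2)))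
  by (unfold Cpseries; f_equal; apply PSeries_ext; intros n; apply Cpseries_deriv_parts).
rewrite E; apply injective_projections; unfold scal, mult, RtoC;
  cbn -[PSeries pow]; unfold mult; cbn -[PSeries pow]; ring.
Qed.

(** The terms are dominated by those of an exponential series, which tend to 0 at every point,
    whereas outside the disk of convergence the terms cannot tend to 0. *)
Lemma CV_radius_infinite_of_bound (a : nat -> R) (A K : R) :
  (forall n, Rabs (a n) <= A * (K ^ n / INR (fact n))) ->
  forall t : R, Rbar_lt (Rabs t) (CV_radius a).
Proof.
intros H t; apply Rbar_not_le_lt; intros Hle.
(* Adding 1 puts [r] strictly outside the disk if the radius is at most [Rabs t]. *)
set (r := Rabs t + 1).
assert (Hr : 0 <= r) by (unfold r; generalize (Rabs_pos t); lra).
apply (CV_disk_outside a r).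
- apply Rbar_le_lt_trans with (1 := Hle); simpl.
  rewrite (Rabs_pos_eq r Hr); unfold r; lra.
- apply is_lim_seq_abs_0.
  apply is_lim_seq_le_le with (u := fun _ => 0)
    (w := fun n => A * ((K * r) ^ n / INR (fact n))).
  + intros n; split; [apply Rabs_pos|].
    rewrite Rabs_mult, (Rabs_pos_eq (r ^ n)) by now apply pow_le.
    rewrite Rpow_mult_distr.
    replace (A * (K ^ n * r ^ n / INR (fact n)))
      with (A * (K ^ n / INR (fact n)) * r ^ n) by (unfold Rdiv; ring).
    apply Rmult_le_compat_r; [now apply pow_le|apply H].
  + apply is_lim_seq_const.
  + replace (Finite 0) with (Rbar_mult A 0) by (simpl; f_equal; ring).
    apply is_lim_seq_scal_l, is_lim_seq_Reals, cv_speed_pow_fact.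
Qed.

(** * Kummer's equation *)

Definition kummer_rec (a : C) (b : R) (w : C) (c : nat -> C) : Prop :=
  forall n, (c (S n) * RtoC (b + INR n) * RtoC (INR (S n)) =
             (a + RtoC (INR n)) * w * c n)%C.

(** Since |a + n| <= (|a|/b + 1)(b + n), the recurrence multiplies the modulus by at most (|a|/b +
    1)|w|/(n + 1) at each step. *)
Lemma kummer_rec_bound (a : C) (b : R) (w : C) (c : nat -> C) :
  0 < b -> kummer_rec a b w c ->
  forall n, Cmod (c n) <=
    Cmod (c O) * (((Cmod a / b + 1) * Cmod w) ^ n / INR (fact n)).
Proof.
intros Hb H n; induction n as [|n IH]; [simpl; lra|].
assert (Hn := pos_INR n).
assert (HSn := lt_0_INR (S n) (Nat.lt_0_succ n)).
assert (Hf := INR_fact_lt_0 n).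
assert (E := f_equal Cmod (H n)).
rewrite !Cmod_mult, !Cmod_R, !Rabs_pos_eq in E by lra.
assert (Ha := Cmod_ge_0 a); assert (Hw := Cmod_ge_0 w); assert (Hc := Cmod_ge_0 (c n)).
assert (Han : Cmod (a + RtoC (INR n)) <= (Cmod a / b + 1) * (b + INR n)).
{ apply Rle_trans with (1 := Cmod_triangle _ _).
  rewrite Cmod_R, (Rabs_pos_eq _ Hn).
  replace ((Cmod a / b + 1) * (b + INR n))
    with (Cmod a + INR n + (b + Cmod a / b * INR n)) by (field; lra).
  assert (0 <= Cmod a / b) by (apply Rle_div_r; lra).
  assert (0 <= Cmod a / b * INR n) by now apply Rmult_le_pos.
  lra. }
rewrite fact_simpl, mult_INR.
set (K := Cmod a / b + 1) in *.
(* Multiplying by this positive factor makes the left side of the recurrence appear, so that [E] can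
   be substituted. *)
apply Rmult_le_reg_r with (r := (b + INR n) * INR (S n)); [apply Rmult_lt_0_compat; lra|].
rewrite <- Rmult_assoc, E.
replace (Cmod (c O) * ((K * Cmod w) ^ S n / (INR (S n) * INR (fact n))) *
  ((b + INR n) * INR (S n)))
  with (K * (b + INR n) * Cmod w * (Cmod (c O) * ((K * Cmod w) ^ n / INR (fact n))))
  by (simpl pow; field; split; lra).
apply Rmult_le_compat; trivial.
- apply Rmult_le_pos; [apply Cmod_ge_0|trivial].
- apply Rmult_le_compat_r; trivial.
Qed.

Lemma kummer_rec_entire (a : C) (b : R) (w : C) (c : nat -> C) :
  0 < b -> kummer_rec a b w c -> entire c.
Proof.
intros Hb H t; split; eapply CV_radius_infinite_of_bound; intros n;
  (eapply Rle_trans; [|apply (kummer_rec_bound _ _ _ _ Hb H n)]).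
- apply re_le_Cmod.
- apply Rle_trans with (2 := Rmax_Cmod (c n)), Rmax_r.
Qed.

(** Comparing coefficients of t^n gives n(n+1) c_(n+1) + b(n+1) c_(n+1) - w n c_n = a w c_n, which
    is the recurrence. *)
Lemma kummer_ode (a : C) (b : R) (w : C) (c : nat -> C) (t : R) :
  0 < b -> kummer_rec a b w c ->
  (RtoC t * Cpseries (Cpseries_deriv (Cpseries_deriv c)) t
   + (RtoC b - w * RtoC t) * Cpseries (Cpseries_deriv c) t
   = a * w * Cpseries c t)%C.
Proof.
intros Hb H.
assert (H0 := kummer_rec_entire _ _ _ _ Hb H).
assert (H1 := entire_deriv _ H0).
assert (H2 := entire_deriv _ H1).
assert (S1 := is_Cpseries_plus _ _ _ _ _
  (is_Cpseries_shift _ _ _ (Cpseries_correct _ t H2))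
  (is_Cpseries_plus _ _ _ _ _
    (is_Cpseries_scal (RtoC b) _ _ _ (Cpseries_correct _ t H1))
    (is_Cpseries_scal (- w) _ _ _
      (is_Cpseries_shift _ _ _ (Cpseries_correct _ t H1))))).
assert (S2 := is_Cpseries_scal (a * w) _ _ _ (Cpseries_correct _ t H0)).
apply is_Cpseries_unique in S1; apply is_Cpseries_unique in S2.
rewrite <- S2.
transitivity (RtoC t * Cpseries (Cpseries_deriv (Cpseries_deriv c)) t +
  (RtoC b * Cpseries (Cpseries_deriv c) t +
   - w * (RtoC t * Cpseries (Cpseries_deriv c) t)))%C; [ring|].
rewrite <- S1; apply Cpseries_ext; intros n.
specialize (H n).
transitivity (c (S n) * RtoC (b + INR n) * RtoC (INR (S n)) - RtoC (INR n) * w * c n)%C;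
  [|rewrite H; ring].
rewrite RtoC_plus.
(* At index 0 the shifted series contribute 0, in agreement with the factor n in the general
   formula. *)
destruct n as [|m]; unfold Cpseries_shift, Cpseries_deriv.
- simpl INR; ring.
- ring.
Qed.

(** The powers of [w] are absorbed into the coefficients of M[a, b, w t], which leaves the real
    variable t. *)
Definition kummer_coef (a : C) (b : R) (w : C) (n : nat) : C :=
  (pochhammer a n / pochhammer (RtoC b) n * (w ^ n / RtoC (INR (fact n))))%C.

Lemma pochhammer_neq_0 (b : R) (n : nat) : 0 < b -> pochhammer (RtoC b) n <> RtoC 0.
Proof.
intros Hb; induction n as [|n IH]; simpl.
- intros E; apply RtoC_inj in E; lra.
- apply Cmult_neq_0; trivial; rewrite <- RtoC_plus; intros E; apply RtoC_inj in E.
  generalize (pos_INR n); lra.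
Qed.

Lemma kummer_coef_rec (a : C) (b : R) (w : C) :
  0 < b -> kummer_rec a b w (kummer_coef a b w).
Proof.
intros Hb n; unfold kummer_coef; rewrite fact_simpl, mult_INR.
assert (Hp := pochhammer_neq_0 b n Hb).
assert (Hf : RtoC (INR (fact n)) <> RtoC 0)
  by (intros E; apply RtoC_inj in E; generalize (INR_fact_lt_0 n); lra).
assert (HS : RtoC (INR (S n)) <> RtoC 0)
  by (intros E; apply RtoC_inj in E; generalize (lt_0_INR (S n) (Nat.lt_0_succ n)); lra).
assert (Hbn : (RtoC b + RtoC (INR n))%C <> RtoC 0)
  by (rewrite <- RtoC_plus; intros E; apply RtoC_inj in E; generalize (pos_INR n); lra).
cbn [pochhammer]; rewrite Cpow_S, RtoC_plus, RtoC_mult; field; repeat split; trivial.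
Qed.

(** Both sides sum real and imaginary parts separately, and the real factor t^n comes out of each
    part, so the series agree term by term. *)
Lemma kummerM_Cpseries (a : C) (b : R) (w : C) (t : R) :
  kummerM a (RtoC b) (w * RtoC t) = Cpseries (kummer_coef a b w) t.
Proof.
unfold kummerM, CSeries, Cpseries, PSeries; f_equal; apply Series_ext; intros n;
  rewrite Cpow_mult_l, <- RtoC_pow; unfold kummer_coef.
- rewrite Rmult_comm, <- Re_RtoC_mult; f_equal; unfold Cdiv; ring.
- rewrite Rmult_comm, <- Im_RtoC_mult; f_equal; unfold Cdiv; ring.
Qed.

Lemma Cpseries_0 (c : nat -> C) : Cpseries c 0 = c O.
Proof. unfold Cpseries; rewrite !PSeries_0; now destruct (c O). Qed.

(** * The exponential factor and its product with a Kummer series *)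

Definition gauss (beta x : R) : C :=
  Cexp (- (Ci * RtoC beta / RtoC 2) * RtoC (x ^ 2))%C.

Lemma gauss_cos_sin (beta x : R) :
  gauss beta x = (cos (beta / 2 * x ^ 2), - sin (beta / 2 * x ^ 2)).
Proof.
unfold gauss, Cexp.
replace (- (Ci * RtoC beta / RtoC 2) * RtoC (x ^ 2))%C
  with ((0, - (beta / 2 * x ^ 2)) : C).
- unfold Re, Im; simpl fst; simpl snd; rewrite exp_0, cos_neg, sin_neg.
  now rewrite !Rmult_1_l.
- apply injective_projections; simpl; field.
Qed.

Lemma is_derive_within_gauss (D : R -> Prop) (beta x : R) :
  D x -> is_derive_within D (gauss beta) x
    (- (Ci * RtoC beta) * RtoC x * gauss beta x)%C.
Proof.
intros Dx.
eapply is_derive_within_ext;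
  [intros y; symmetry; apply gauss_cos_sin| |apply is_derive_within_pair; trivial].
2: auto_derive; [trivial|reflexivity].
2: auto_derive; [trivial|reflexivity].
rewrite gauss_cos_sin; apply injective_projections; simpl; field.
Qed.

Lemma is_derive_within_const (D : R -> Prop) (z : C) (x : R) :
  D x -> is_derive_within D (fun _ => z) x (RtoC 0).
Proof.
intros Dx; eapply is_derive_within_ext;
  [intros y; symmetry; apply surjective_pairing|reflexivity|].
apply is_derive_within_pair; trivial; apply @is_derive_const.
Qed.

Lemma is_derive_within_RtoC (D : R -> Prop) (x : R) :
  D x -> is_derive_within D RtoC x (RtoC 1).
Proof.
intros Dx; apply (is_derive_within_pair D (fun y => y) (fun _ => 0)); trivial.
- apply @is_derive_id.
- apply @is_derive_const.
Qed.

Section KummerGauss.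

Variables (D : R -> Prop) (a : C) (b beta : R).
Hypothesis Hb : 0 < b.

Let w : C := (Ci * RtoC beta)%C.
Let c := kummer_coef a b w.
Let G0 (x : R) : C := Cpseries c (x ^ 2).
Let G1 (x : R) : C := Cpseries (Cpseries_deriv c) (x ^ 2).
Let G2 (x : R) : C := Cpseries (Cpseries_deriv (Cpseries_deriv c)) (x ^ 2).

Lemma is_derive_within_G0 (x : R) :
  D x -> is_derive_within D G0 x (RtoC (2 * x) * G1 x)%C.
Proof.
intros Dx; apply is_derive_within_Cpseries_sqr; trivial.
eapply kummer_rec_entire, kummer_coef_rec; exact Hb.
Qed.

Lemma is_derive_within_G1 (x : R) :
  D x -> is_derive_within D G1 x (RtoC (2 * x) * G2 x)%C.
Proof.
intros Dx; apply is_derive_within_Cpseries_sqr; trivial.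
eapply entire_deriv, kummer_rec_entire, kummer_coef_rec; exact Hb.
Qed.

Definition kummer_gauss (x : R) : C := (gauss beta x * G0 x)%C.

(** The exponential contributes [- w * x] and the chain rule [2 * x]; factoring out [x] makes the
    value 0 at the origin evident. *)
Definition kummer_gauss' (x : R) : C :=
  (gauss beta x * (RtoC x * (RtoC 2 * G1 x - w * G0 x)))%C.

Lemma is_derive_within_kummer_gauss (x : R) :
  D x -> is_derive_within D kummer_gauss x (kummer_gauss' x).
Proof.
intros Dx; eapply is_derive_within_ext; [intros y; reflexivity| |
  apply is_derive_within_mult; [trivial|apply is_derive_within_gauss; trivial|
  apply is_derive_within_G0; trivial]].
unfold kummer_gauss', w; rewrite RtoC_mult; ring.
Qed.

(** Differentiation produces 4 x^2 G2, which Kummer's equation at t = x^2 trades for G1 and G0. What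
    is left of G1 has the constant coefficient 2 - 4b, equal to 0 for b = 1/2 and to -4 for b =
    3/2. *)
Lemma is_derive_within_kummer_gauss' (x : R) :
  D x -> is_derive_within D kummer_gauss' x
   (gauss beta x * ((RtoC (2 - 4 * b)) * G1 x
      + (w * w * RtoC (x ^ 2) + RtoC 4 * a * w - w) * G0 x))%C.
Proof.
intros Dx.
assert (K := kummer_ode a b w c (x ^ 2) Hb (kummer_coef_rec a b w Hb)).
fold (G0 x) (G1 x) (G2 x) in K.
eapply is_derive_within_ext; [intros y; reflexivity| |
  apply is_derive_within_mult; [trivial|apply is_derive_within_gauss; trivial|
  apply is_derive_within_mult; [trivial|apply is_derive_within_RtoC; trivial|
  apply is_derive_within_minus; apply is_derive_within_mult; trivial;
   [apply is_derive_within_const|apply is_derive_within_G1|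
    apply is_derive_within_const|apply is_derive_within_G0]; trivial]]].
assert (K' : (RtoC (x ^ 2) * G2 x =
  a * w * G0 x - (RtoC b - w * RtoC (x ^ 2)) * G1 x)%C)
  by (rewrite <- K; ring).
fold w.
transitivity (gauss beta x * (RtoC 4 * (RtoC (x ^ 2) * G2 x)
  + (RtoC 2 - RtoC 4 * w * RtoC (x ^ 2)) * G1 x
  + (w * w * RtoC (x ^ 2) - w) * G0 x))%C.
- rewrite !RtoC_mult, RtoC_pow; ring.
- rewrite K', RtoC_minus, RtoC_mult; ring.
Qed.

End KummerGauss.

(** * The parabolic barrier *)

(** This is the body of [is_solution] with the derivatives as parameters, since Wronskians refer to
    them. *)
Definition solves_within (alpha U0 k : R) (psi dpsi ddpsi : R -> C) : Prop :=
  forall x : R, barrier alpha x ->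
    is_derive_within (barrier alpha) psi x (dpsi x) /\
    is_derive_within (barrier alpha) dpsi x (ddpsi x) /\
    (ddpsi x
     + RtoC (2 * U0 / alpha ^ 2 * x ^ 2 - (2 * U0 - k ^ 2)) * psi x)%C = RtoC 0.

(** The equation has no first-order term: (f g' - f' g)' = f g'' - f'' g, and the potential terms
    cancel. *)
Lemma wronskian_const (alpha U0 k : R) (f df ddf g dg ddg : R -> C) :
  0 < alpha ->
  solves_within alpha U0 k f df ddf -> solves_within alpha U0 k g dg ddg ->
  forall x, barrier alpha x ->
  (f x * dg x - df x * g x)%C = (f 0 * dg 0 - df 0 * g 0)%C.
Proof.
intros Ha Hf Hg x Hx.
apply (is_derive_within_zero_const alpha (fun y => f y * dg y - df y * g y)%C Ha);
  [|exact Hx|unfold barrier; lra].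
clear x Hx; intros x Hx.
destruct (Hf x Hx) as [F1 [F2 F3]]; destruct (Hg x Hx) as [G1 [G2 G3]].
eapply is_derive_within_ext; [intros y; reflexivity| |
  apply is_derive_within_minus; apply is_derive_within_mult;
  [exact Hx|exact F1|exact G2|exact Hx|exact F2|exact G1]].
set (q := RtoC _) in F3, G3.
(* Adding and subtracting q f g exhibits the two equations inside the derivative of the
   Wronskian. *)
transitivity (f x * (ddg x + q * g x) - (ddf x + q * f x) * g x)%C; [ring|].
rewrite F3, G3; ring.
Qed.

(** A derivative relative to the whole line is an ordinary one, determined by the values of [f] near
    [x]. Linear independence uses this at the origin. *)
Lemma is_derive_within_eq_0 (D : R -> Prop) (f : R -> C) (x : R) (l : C) :
  locally x D -> is_derive_within (fun _ => True) f x l ->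
  (forall y, D y -> f y = RtoC 0) -> l = RtoC 0.
Proof.
intros HD H H0; apply is_derive_within_components in H; destruct H as [H1 H2].
assert (aux : forall (g : R -> R) (u : R), real_derive_within (fun _ => True) g x u ->
  (forall y, D y -> g y = 0) -> u = 0).
{ intros g u [Hl Hg] Hz.
  assert (Hd : is_derive g x u).
  { split; [exact Hl|].
    intros y Hy; replace y with x
      by apply (is_filter_lim_locally_unique (K := R_AbsRing) (V := R_NormedModule) _ _ Hy).
    intros eps; generalize (Hg x (within_filter_lim _ _) eps); unfold within.
    apply filter_imp; auto. }
  rewrite <- (is_derive_unique _ _ _ Hd), (Derive_ext_loc g (fun _ => 0)).
  - apply Derive_const.
  - revert HD; apply filter_imp; intros y Dy; now apply Hz. }
apply injective_projections.
- apply (aux _ _ H1); intros y Dy; now rewrite H0.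
- apply (aux _ _ H2); intros y Dy; now rewrite H0.
Qed.

(** * The even and odd functions as solutions, with their data at the origin *)

Lemma psi_e_kummer_gauss (alpha beta k x : R) :
  psi_e alpha beta k x =
  kummer_gauss (RtoC (1 / 4) * (RtoC 1 + Ci * RtoC (k ^ 2) / RtoC beta
                 - Ci * RtoC (alpha ^ 2) * RtoC beta))%C (1 / 2) beta x.
Proof. unfold psi_e; now rewrite kummerM_Cpseries. Qed.

Lemma psi_o_kummer_gauss (alpha beta k x : R) :
  psi_o alpha beta k x =
  (RtoC x * RtoC (sqrt (2 * beta)) *
   kummer_gauss (RtoC (1 / 4) * (RtoC 3 + Ci * RtoC (k ^ 2) / RtoC beta
                 - Ci * RtoC (alpha ^ 2) * RtoC beta)) (3 / 2) beta x)%C.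
Proof.
unfold psi_o; rewrite kummerM_Cpseries, RtoC_mult.
unfold kummer_gauss, gauss; ring.
Qed.

Lemma kummer_gauss_0 (a : C) (b beta : R) : kummer_gauss a b beta 0 = RtoC 1.
Proof.
unfold kummer_gauss; rewrite gauss_cos_sin.
replace (0 ^ 2) with 0 by ring.
rewrite Cpseries_0; replace (beta / 2 * 0) with 0 by ring.
rewrite cos_0, sin_0; unfold kummer_coef; simpl.
apply injective_projections; simpl; field.
Qed.

Lemma kummer_gauss'_0 (a : C) (b beta : R) : kummer_gauss' a b beta 0 = RtoC 0.
Proof. unfold kummer_gauss'; ring. Qed.

Lemma psi_e_solves (alpha beta k : R) (D : R -> Prop) :
  0 < beta ->
  exists dpsi ddpsi : R -> C,
    (forall x, D x -> is_derive_within D (psi_e alpha beta k) x (dpsi x) /\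
      is_derive_within D dpsi x (ddpsi x) /\
      (ddpsi x + RtoC (beta ^ 2 * x ^ 2 - (alpha ^ 2 * beta ^ 2 - k ^ 2)) *
         psi_e alpha beta k x = RtoC 0)%C) /\
    psi_e alpha beta k 0 = RtoC 1 /\ dpsi 0 = RtoC 0.
Proof.
intros Hb.
assert (H12 : 0 < 1 / 2) by lra.
set (a := (RtoC (1 / 4) * (RtoC 1 + Ci * RtoC (k ^ 2) / RtoC beta
                 - Ci * RtoC (alpha ^ 2) * RtoC beta))%C).
eexists; eexists; split; [intros x Dx; split; [|split]|split].
- eapply is_derive_within_ext;
    [intros y; symmetry; apply psi_e_kummer_gauss|reflexivity|].
  now apply is_derive_within_kummer_gauss.
- now apply is_derive_within_kummer_gauss'.
- rewrite psi_e_kummer_gauss; fold a.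
  (* The first Kummer parameter is chosen for this identity: the constant term of the second
     derivative becomes real and cancels that of the potential. *)
  assert (Ea : (RtoC 4 * a * (Ci * RtoC beta) - Ci * RtoC beta =
    RtoC (alpha ^ 2 * beta ^ 2 - k ^ 2))%C)
    by (unfold a; apply injective_projections; simpl; field; lra).
  assert (Ew : (Ci * RtoC beta * (Ci * RtoC beta) * RtoC (x ^ 2) =
    - RtoC (beta ^ 2 * x ^ 2))%C)
    by (apply injective_projections; simpl; ring).
  replace (2 - 4 * (1 / 2)) with 0 by field.
  unfold kummer_gauss.
  set (G := Cpseries (kummer_coef _ _ _) (x ^ 2)).
  transitivity (gauss beta x * G *
    ((Ci * RtoC beta * (Ci * RtoC beta) * RtoC (x ^ 2)) +
     (RtoC 4 * a * (Ci * RtoC beta) - Ci * RtoC beta) +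
     RtoC (beta ^ 2 * x ^ 2 - (alpha ^ 2 * beta ^ 2 - k ^ 2))))%C.
  + ring.
  + rewrite Ea, Ew, (RtoC_minus (beta ^ 2 * x ^ 2)); ring.
- rewrite psi_e_kummer_gauss; apply kummer_gauss_0.
- apply kummer_gauss'_0.
Qed.

(** With [phi] the product for b = 3/2, (x phi)'' = 2 phi' + x phi''; the term 4 x G1 of 2 phi'
    cancels the -4 x G1 of x phi''. The set [D] is general because both the barrier and the whole
    line are used later. *)
Lemma psi_o_solves (alpha beta k : R) (D : R -> Prop) :
  0 < beta ->
  exists dpsi ddpsi : R -> C,
    (forall x, D x -> is_derive_within D (psi_o alpha beta k) x (dpsi x) /\
      is_derive_within D dpsi x (ddpsi x) /\
      (ddpsi x + RtoC (beta ^ 2 * x ^ 2 - (alpha ^ 2 * beta ^ 2 - k ^ 2)) *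
         psi_o alpha beta k x = RtoC 0)%C) /\
    psi_o alpha beta k 0 = RtoC 0 /\ dpsi 0 = RtoC (sqrt (2 * beta)).
Proof.
intros Hb.
assert (H32 : 0 < 3 / 2) by lra.
set (a := (RtoC (1 / 4) * (RtoC 3 + Ci * RtoC (k ^ 2) / RtoC beta
                 - Ci * RtoC (alpha ^ 2) * RtoC beta))%C).
set (s := RtoC (sqrt (2 * beta))).
set (phi := kummer_gauss a (3 / 2) beta).
set (phi' := kummer_gauss' a (3 / 2) beta).
assert (D1 : forall x, D x -> is_derive_within D phi x (phi' x))
  by (intros; now apply is_derive_within_kummer_gauss).
assert (D2 := fun x => is_derive_within_kummer_gauss' D a (3 / 2) beta H32 x).
assert (Dl : forall x, D x -> is_derive_within D (fun y => RtoC y * s)%C x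
    (RtoC 1 * s + RtoC x * RtoC 0)%C)
  by (intros x Dx; apply is_derive_within_mult; trivial;
      [now apply is_derive_within_RtoC|now apply is_derive_within_const]).
exists (fun x => s * phi x + RtoC x * s * phi' x)%C; eexists;
  split; [intros x Dx; split; [|split]|split].
- eapply is_derive_within_ext;
    [intros y; symmetry; apply psi_o_kummer_gauss| |
     apply is_derive_within_mult; [trivial|apply Dl, Dx|apply D1, Dx]].
  cbv beta; fold a s phi; ring.
- apply is_derive_within_plus; apply is_derive_within_mult; trivial.
  + now apply is_derive_within_const.
  + apply D1, Dx.
  + apply Dl, Dx.
  + apply D2, Dx.
- rewrite psi_o_kummer_gauss; fold a s phi.
  (* Of the three multiples of w subtracted here, one comes from phi'' and two from 2 phi'. *)
  assert (Ea : (RtoC 4 * a * (Ci * RtoC beta) - RtoC 3 * (Ci * RtoC beta) =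
    RtoC (alpha ^ 2 * beta ^ 2 - k ^ 2))%C)
    by (unfold a; apply injective_projections; simpl; field; lra).
  assert (Ew : (Ci * RtoC beta * (Ci * RtoC beta) * RtoC (x ^ 2) =
    - RtoC (beta ^ 2 * x ^ 2))%C)
    by (apply injective_projections; simpl; ring).
  replace (2 - 4 * (3 / 2)) with (- (4)) by field.
  unfold phi', phi, kummer_gauss', kummer_gauss.
  set (G := Cpseries (kummer_coef _ _ _) (x ^ 2)).
  transitivity (RtoC x * s * (gauss beta x * G) *
    ((Ci * RtoC beta * (Ci * RtoC beta) * RtoC (x ^ 2)) +
     (RtoC 4 * a * (Ci * RtoC beta) - RtoC 3 * (Ci * RtoC beta)) +
     RtoC (beta ^ 2 * x ^ 2 - (alpha ^ 2 * beta ^ 2 - k ^ 2))))%C.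
  + rewrite RtoC_opp; ring.
  + rewrite Ea, Ew, (RtoC_minus (beta ^ 2 * x ^ 2)); ring.
- rewrite psi_o_kummer_gauss; ring.
- unfold phi, phi'; rewrite kummer_gauss_0, kummer_gauss'_0; ring.
Qed.

Theorem mainTheorem1 (alpha U0 k : R)
    (Halpha : 0 < alpha) (HU0 : 0 < U0) (Hk : 0 < k) :
  let beta := sqrt (2 * U0) / alpha in
  let psie := psi_e alpha beta k in
  let psio := psi_o alpha beta k in
  (is_solution alpha U0 k psie /\ even_on (barrier alpha) psie) /\
  (is_solution alpha U0 k psio /\ odd_on (barrier alpha) psio) /\
  lin_indep_on (barrier alpha) psie psio /\
  (forall psi : R -> C, is_solution alpha U0 k psi ->
     exists a b : C, forall x : R, barrier alpha x ->
       psi x = (a * psie x + b * psio x)%C).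
Proof.
intros beta psie psio.
assert (Hbeta : 0 < beta)
  by (apply Rdiv_lt_0_compat; [apply sqrt_lt_R0; lra|exact Halpha]).
assert (Hbeta2 : alpha ^ 2 * beta ^ 2 = 2 * U0).
{ unfold beta; replace (alpha ^ 2 * (sqrt (2 * U0) / alpha) ^ 2)
    with (sqrt (2 * U0) ^ 2) by (field; lra).
  apply pow2_sqrt; lra. }
assert (Hbeta2' : 2 * U0 / alpha ^ 2 = beta ^ 2) by (rewrite <- Hbeta2; field; lra).
destruct (psi_e_solves alpha beta k (barrier alpha) Hbeta) as [de [dde [He [e0 de0]]]].
destruct (psi_o_solves alpha beta k (barrier alpha) Hbeta) as [do [ddo [Ho [o0 do0]]]].
(* The coefficients in [beta] become those of the original equation. *)
rewrite Hbeta2, <- Hbeta2' in He, Ho.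
fold psie psio in He, Ho, e0, o0.
set (s := RtoC (sqrt (2 * beta))) in do0.
assert (Hs : s <> RtoC 0)
  by (intros E; apply RtoC_inj in E; generalize (sqrt_lt_R0 (2 * beta)); lra).
assert (B0 : barrier alpha 0) by (unfold barrier; lra).
split; [split|split; [split|split]].
- now exists de, dde.
- intros x _; unfold psie, psi_e; now replace ((- x) ^ 2) with (x ^ 2) by ring.
- now exists do, ddo.
- intros x _; unfold psio, psi_o; replace ((- x) ^ 2) with (x ^ 2) by ring.
  replace (- x * sqrt (2 * beta)) with (- (x * sqrt (2 * beta))) by ring.
  rewrite RtoC_opp; ring.
- intros a b Hab.
  (* At the origin [psie] is 1 and [psio] is 0, so the relation there reads a = 0. *)
  assert (Ea : a = RtoC 0).
  { rewrite <- (Hab 0 B0), e0, o0; ring. }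
  split; [exact Ea|].
  (* If [b] were nonzero, [psio] would vanish on the barrier, and so would its derivative [s] at the
     interior point 0. *)
  destruct (Ceq_dec b (RtoC 0)) as [Eb|Eb]; [exact Eb|exfalso; apply Hs].
  destruct (psi_o_solves alpha beta k (fun _ => True) Hbeta)
    as [do' [ddo' [Ho' [_ do0']]]].
  unfold s; rewrite <- do0'.
  apply (is_derive_within_eq_0 (barrier alpha) psio 0); [|apply Ho'; exact I|].
  + exists (mkposreal _ Halpha); intros y Hy.
    unfold ball in Hy; simpl in Hy; unfold AbsRing_ball, abs, minus, plus, opp in Hy.
    simpl in Hy; apply Rabs_lt_between in Hy; unfold barrier; lra.
  + intros y Hy; specialize (Hab y Hy); rewrite Ea in Hab.
    replace (psio y) with (/ b * (RtoC 0 * psie y + b * psio y))%C by (field; trivial).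
    rewrite Hab; ring.
- intros psi [dpsi [ddpsi Hpsi]].
  set (A := (psi 0 * do 0 - dpsi 0 * psio 0)%C).
  set (B := (psi 0 * de 0 - dpsi 0 * psie 0)%C).
  (* The coefficients are the Wronskians of [psi] with [psio] and [psie], divided by W(psi_e, psi_o)
     = [s]. *)
  exists (A / s)%C, (- (B / s))%C; intros x Hx.
  assert (WA := wronskian_const _ _ _ _ _ _ _ _ _ Halpha Hpsi Ho x Hx).
  assert (WB := wronskian_const _ _ _ _ _ _ _ _ _ Halpha Hpsi He x Hx).
  assert (WS := wronskian_const _ _ _ _ _ _ _ _ _ Halpha He Ho x Hx).
  rewrite e0, de0, o0, do0 in WS.
  (* By constancy the Wronskians at 0 are replaced by those at [x], after which the expansion is an
     algebraic identity at the single point [x]. *)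
  fold A in WA; fold B in WB; rewrite <- WA, <- WB.
  assert (WS' : s = (psie x * do x - de x * psio x)%C) by (rewrite WS; ring).
  transitivity (psi x * (psie x * do x - de x * psio x) / s)%C.
  + rewrite <- WS'; field; exact Hs.
  + field; exact Hs.
Qed.
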